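(* For all integers $n,k\geqslant 1$, $$(-1)^{k-1}\sum_{j=0}^{k-1} (-1)^{j}\Big(\mathrm{pod}\big(n-j(2j+1)\big)-\mathrm{pod}\big(n-(j+1)(2j+1)\big)\Big)\geqslant 0,$$ with strict inequality if $n\geqslant (2k+1)k$. For example, for all $n\geqslant 1$, $$\mathrm{pod}(n)-\mathrm{pod}(n-1)-\mathrm{pod}(n-3)+\mathrm{pod}(n-6)\leqslant 0,$$ $$\mathrm{pod}(n)-\mathrm{pod}(n-1)-\mathrm{pod}(n-3)+\mathrm{pod}(n-6)+\mathrm{pod}(n-10)-\mathrm{pod}(n-15)\geqslant 0.$$
   Context: $\mathrm{pod}(n)$ denotes the number of partitions of $n$ wherein odd parts are distinct (even parts may repeat), with $\mathrm{pod}(0)=1$ and $\mathrm{pod}(m)=0$ for all negative integers $m$. Equivalently, $\sum_{n=0}^{\infty}\mathrm{pod}(n) q^n=\prod_{n=1}^\infty \frac{1+q^{2n-1}}{1-q^{2n}}=1+q+q^2+2q^3+3q^4+4q^5+5q^6+7q^7+\cdots$. *)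

(* Defs.v *)
From mathcomp Require Import all_boot all_order all_algebra.
Set Implicit Arguments.
Unset Strict Implicit.
Unset Printing Implicit Defensive.

(* Parts are listed in weakly decreasing order. *)
Definition is_partition (n : nat) (s : seq nat) : bool :=
  [&& sorted geq s, all (leq 1) s & sumn s == n].

Definition odd_parts_distinct (s : seq nat) : bool :=
  uniq [seq x <- s | odd x].

(* A partition of n has at most n parts, each at most n, so all partitions of
   n occur in the finite type of sequences of length <= n over {0, ..., n}. *)
Definition pod_nat (n : nat) : nat :=
  #|[set s : n.-bseq 'I_n.+1 |
      is_partition n (map val s) && odd_parts_distinct (map val s)]|.

Definition pod (m : int) : int :=
  match m with
  | Posz n => Posz (pod_nat n)
  | Negz _ => Posz 0
  end.

(* Main.v *)
(* Write a_m = prod_{i<m} (1 + q^(2i+1)), h_m = prod_{1<=i<=m} 1/(1 - q^(2i))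
   and P = a_oo h_oo = sum pod(n) q^n.  The truncated Gauss identity of Guo and
   Zeng reads, in a form without q-binomials,
     P * sum_{j<k} (-1)^j q^(j(2j+1)) (1 - q^(2j+1)) = 1 - (-1)^k R_k,
     R_k = q^(k(2k+1)) a_k h_k
           (1 + (1 - q^(2k)) sum_{m>=1} a_m h_m q^(2(k+1)m) / (1 - q^(2(m+k)))).
   It follows by induction on k from
     R_0 = 1,  R_k + R_{k+1} = P q^(k(2k+1)) (1 - q^(2k+1)):
   termwise, R_k + R_{k+1} collapses to a multiple of the q-binomial series
   sum_m a_m h_m q^(2(k+1)m), which is an infinite product.  For k >= 1 the
   factor 1 - q^(2k) cancels against h_k, so R_k has nonnegative coefficients
   and dominates q^(k(2k+1)) (1 + q) / (1 - q^2) = q^(k(2k+1)) / (1 - q).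
   Power series are taken modulo q^(n+1), in Z[X]/(X^(n+1)). *)

Require Import Defs.
From mathcomp Require Import all_boot all_order all_algebra.
From mathcomp Require Import ring zify.
Import Order.TTheory GRing.Theory Num.Theory.
Local Open Scope ring_scope.
Set Implicit Arguments.
Unset Strict Implicit.
Unset Printing Implicit Defensive.

(** * The truncated Gauss identity over a ring with nilpotent q *)

Section Nilpotent.
Variables (A : comNzRingType) (q : A) (M : nat).
Hypotheses (M_gt0 : (0 < M)%N) (qM0 : q ^+ M = 0).

(** For [0 < d] this inverts 1 - q^d, since (q^d)^M = 0. Below, [oddpr m] is a_m and [evenpr m] is
    h_m. *)
Definition geom d : A := \sum_(i < M) q ^+ d ^+ i.

Definition oddpr m : A := \prod_(i < m) (1 + q ^+ (2 * i + 1)).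

Definition evenpr m : A := \prod_(i < m) geom (2 * i.+1).

Lemma exprq0 d : (0 < d)%N -> (q ^+ d) ^+ M = 0.
Proof. by move=> d0; rewrite exprAC qM0 expr0n eqn0Ngt d0. Qed.

Lemma geomK d : (0 < d)%N -> geom d * (1 - q ^+ d) = 1.
Proof.
move=> d0; rewrite /geom mulrC -opprB mulNr -subrX1.
by rewrite exprq0 // sub0r opprK.
Qed.

Lemma oddprS m : oddpr m.+1 = oddpr m * (1 + q ^+ (2 * m + 1)).
Proof. by rewrite /oddpr big_ord_recr. Qed.

Lemma evenprS m : evenpr m.+1 = evenpr m * geom (2 * m.+1).
Proof. by rewrite /evenpr big_ord_recr. Qed.

Lemma evenprK m : evenpr m.+1 * (1 - q ^+ (2 * m.+1)) = evenpr m.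
Proof. by rewrite evenprS -mulrA geomK // mulr1. Qed.

(** Terms of the q-binomial series F(z) = sum_m a_m h_m z^m at z = q^(2(k+1)); they vanish from m =
    M on. *)
Definition binterm k m : A := oddpr m * evenpr m * (q ^+ (2 * k.+1)) ^+ m.

Definition binsum k : A := \sum_(m < M) binterm k m.

Lemma binterm0 k : binterm k 0 = 1.
Proof. by rewrite /binterm /oddpr /evenpr !big_ord0 expr0 !mulr1. Qed.

Lemma bintermM k : binterm k M = 0.
Proof. by rewrite /binterm exprq0 // mulr0. Qed.

Lemma expr2S x : q ^+ (2 * x.+1) = q ^+ 2 * q ^+ (2 * x).
Proof. by rewrite mulnS exprD. Qed.

(** The functional equation (1 - z) F(z) = (1 + q z) F(q^2 z) at z = q^(2(k+1)); the difference of
    the two sides telescopes. *)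
Lemma binsumS k :
  (1 - q ^+ (2 * k.+1)) * binsum k = (1 + q ^+ (2 * k.+1 + 1)) * binsum k.+1.
Proof.
(* Both boundary values vanish: [v 0] contains 1 - q^0 and [v M] contains z^M = 0. *)
pose v m := - (binterm k m * (1 - q ^+ (2 * m))).
apply/eqP; rewrite -subr_eq0 /binsum !mulr_sumr -sumrB; apply/eqP.
transitivity (\sum_(0 <= m < M) (v m.+1 - v m)); last first.
  rewrite telescope_sumr // /v bintermM mul0r oppr0 muln0 expr0 subrr mulr0.
  by rewrite oppr0 subrr.
rewrite big_mkord; apply: eq_bigr => m _.
rewrite /v /binterm -(evenprK m) oddprS.
have -> : (q ^+ (2 * k.+2)) ^+ m = (q ^+ (2 * k.+1)) ^+ m * q ^+ (2 * m).
  by rewrite -!exprM -exprD; congr (_ ^+ _); lia.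
rewrite (exprS _ m) !addn1 !(exprS _ (2 * _)) !expr2S.
move: (q ^+ (2 * k)) (q ^+ (2 * m)) (oddpr m) (evenpr m.+1) => K Y a h.
move: ((q ^+ 2 * K) ^+ m) => z; ring.
Qed.

(** By [binsumS] the left side does not depend on [k]. At [k = M] the series is 1 and the last
    factor of [oddpr M.+1] is 1, both because q^M = 0; what remains is P. *)
Lemma binsum_const k : oddpr k.+1 * evenpr k * binsum k = oddpr M * evenpr M.
Proof.
have step j : oddpr j.+2 * evenpr j.+1 * binsum j.+1
            = oddpr j.+1 * evenpr j * binsum j.
  rewrite (oddprS j.+1) -(evenprK j).
  have := binsumS j.
  move: (binsum _) (binsum _) (oddpr _) (evenpr _) (1 + _) (1 - _).
  move=> x y a h d c H.
  by ring: H.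
have const j : oddpr j.+1 * evenpr j * binsum j
             = oddpr 1 * evenpr 0 * binsum 0.
  by elim: j => // j <-.
rewrite const -(const M) oddprS exprD (mulnC 2) exprM qM0 expr0n mul0r addr0.
rewrite mulr1 /binsum (bigD1 (Ordinal M_gt0)) //= binterm0.
rewrite big1 ?addr0 ?mulr1 //.
case=> [[|m] /= lt_m] // _; rewrite /binterm mulnS exprD (mulnC 2) exprM qM0.
by rewrite expr0n mulr0 expr0n mulr0.
Qed.

(** [headsum k] is the sum over m >= 1 in R_k, reindexed from 0. [tailsum k] is the sum in R_(k+1)
    with a term m = 0 added, so that the denominators of the two agree termwise. *)
Definition tailsum k : A := \sum_(m < M)
  oddpr m * evenpr m * geom (2 * (m + k).+1) * (q ^+ (2 * k.+2)) ^+ m.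

Definition headsum k : A := \sum_(m < M)
  oddpr m.+1 * evenpr m.+1 * geom (2 * (m + k).+1) * (q ^+ (2 * k.+1)) ^+ m.+1.

(** This is R_k + R_(k+1) without the common factor q^(k(2k+1)) a_k h_k. On the right, term m + 1 of
    one copy of the series is paired with term m of the other. *)
Lemma head_tail_binsum k :
  1 + (1 - q ^+ (2 * k)) * headsum k
    + (1 + q ^+ (2 * k + 1)) * q ^+ (4 * k + 3) * tailsum k
  = (1 - q ^+ (2 * (2 * k + 1))) * binsum k.
Proof.
have shift : binsum k = 1 + \sum_(m < M) binterm k m.+1.
  transitivity (\sum_(m < M.+1) binterm k m).
    by rewrite big_ord_recr /= bintermM addr0.
  by rewrite big_ord_recl binterm0.
rewrite [RHS]mulrBl mul1r {1}shift -!addrA; congr (1 + _).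
rewrite /headsum /tailsum /binsum !mulr_sumr -big_split /= -sumrB.
apply: eq_bigr => m _.
rewrite /binterm -(evenprK m) oddprS.
have := @geomK (2 * (m + k).+1) isT.
have -> : (q ^+ (2 * k.+2)) ^+ m = (q ^+ (2 * k.+1)) ^+ m * q ^+ (2 * m).
  by rewrite -!exprM -exprD; congr (_ ^+ _); lia.
have -> : q ^+ (4 * k + 3) = q ^+ (2 * k) ^+ 2 * q ^+ 3.
  by rewrite -exprM -exprD; congr (_ ^+ _); lia.
have -> : q ^+ (2 * (2 * k + 1)) = q ^+ (2 * k) ^+ 2 * q ^+ 2.
  by rewrite -exprM -exprD; congr (_ ^+ _); lia.
have -> : q ^+ (2 * (m + k).+1) = q ^+ 2 * (q ^+ (2 * m) * q ^+ (2 * k)).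
  by rewrite expr2S mulnDr exprD.
rewrite (exprS _ m) !addn1 !(exprS _ (2 * _)) !expr2S.
move: (q ^+ (2 * k)) (q ^+ (2 * m)) (oddpr m) (evenpr m.+1) => K Y a h.
move: ((q ^+ 2 * K) ^+ m) (geom _) => z g H.
(* Over the common denominator 1 - q^(2(m+k+1)), the numerator is divisible by that denominator; [H]
   cancels it. *)
transitivity (a * h * z * q ^+ 2 * K * (g * (1 - q ^+ 2 * (Y * K)))
              * ((1 + q * Y) - K * (1 - q ^+ 2 * Y))); first by ring.
rewrite H; ring.
Qed.

Definition remainder k : A :=
  q ^+ (k * (2 * k + 1)) * oddpr k * evenpr k
  * (1 + (1 - q ^+ (2 * k)) * headsum k).

Lemma remainder0 : remainder 0 = 1.
Proof.
rewrite /remainder mul0n muln0 expr0 subrr mul0r addr0 /oddpr /evenpr.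
by rewrite !big_ord0 !mulr1.
Qed.

Lemma tailsum_head k :
  tailsum k = geom (2 * k.+1) + headsum k.+1.
Proof.
transitivity (\sum_(m < M.+1)
   oddpr m * evenpr m * geom (2 * (m + k).+1) * (q ^+ (2 * k.+2)) ^+ m).
  by rewrite big_ord_recr /= exprq0 // mulr0 addr0.
rewrite big_ord_recl /= add0n /oddpr /evenpr !big_ord0 expr0 !(mul1r, mulr1).
congr (_ + _); apply: eq_bigr => i _.
by rewrite /bump add1n addSnnS.
Qed.

(** Gives R_(k+1) the prefactor of R_k: 1 - q^(2k+2) turns h_(k+1) into h_k, and its product with
    the m = 0 term of [tailsum] is the summand 1 of R_(k+1). *)
Lemma remainderS k : remainder k.+1 =
  q ^+ (k * (2 * k + 1)) * oddpr k * evenpr k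
  * ((1 + q ^+ (2 * k + 1)) * q ^+ (4 * k + 3) * tailsum k).
Proof.
rewrite /remainder tailsum_head oddprS -(evenprK k).
have -> : q ^+ (k.+1 * (2 * k.+1 + 1))
        = q ^+ (k * (2 * k + 1)) * q ^+ (4 * k + 3).
  by rewrite -exprD; congr (_ ^+ _); lia.
have := @geomK (2 * k.+1) isT.
move: (headsum _) (geom _) (_ ^+ (2 * k.+1)) => s g Q H.
have <- : (1 - Q) * (g + s) = 1 + (1 - Q) * s by rewrite mulrDr mulrC H.
ring.
Qed.

(** Of the factors of 1 - q^(2(2k+1)), 1 + q^(2k+1) turns a_k into a_(k+1), so that [binsum_const]
    applies, and 1 - q^(2k+1) remains. *)
Lemma remainder_add k : remainder k + remainder k.+1 =
  oddpr M * evenpr M * (q ^+ (k * (2 * k + 1)) - q ^+ ((k + 1) * (2 * k + 1))).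
Proof.
rewrite remainderS {1}/remainder -mulrDr head_tail_binsum -(binsum_const k).
rewrite oddprS (mulnDl k) mul1n (exprD q (k * _)).
rewrite (mulnC 2 (2 * k + 1)%N) (exprM _ _ 2).
ring.
Qed.

Lemma theta_truncation k :
  oddpr M * evenpr M * (\sum_(0 <= j < k) (-1) ^+ j *
     (q ^+ (j * (2 * j + 1)) - q ^+ ((j + 1) * (2 * j + 1))))
  = 1 - (-1) ^+ k * remainder k.
Proof.
elim: k => [|k IHk]; first by rewrite big_nil remainder0 mulr0 mulr1 subrr.
rewrite big_nat_recr //= mulrDr IHk [X in _ + X]mulrCA -remainder_add exprS.
ring.
Qed.

End Nilpotent.

(** * Coefficients modulo q^(n+1) and positivity of R_k *)

Section Coefficients.
Variable n : nat.
Local Notation series := {poly %/ ('X^(n.+1) : {poly int})}.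
Local Notation q := ('qX : series).
Implicit Types x y : series.

Lemma coef_in_qpoly (p : {poly int}) i :
  (in_qpoly 'X^(n.+1) p : {poly int})`_i = if (i <= n)%N then p`_i else 0.
Proof.
by rewrite /= mk_monic_Xn -Pdiv.RingMonic.take_poly_rmodp coef_take_poly.
Qed.

Lemma coef_qpolyM x y i :
  (x * y : series)`_i =
  if (i <= n)%N then \sum_(j < i.+1) x`_j * y`_(i - j) else 0.
Proof. by rewrite coef_in_qpoly coefM. Qed.

Lemma in_qpolyK x : in_qpoly 'X^(n.+1) x = x.
Proof. by apply/val_inj/in_qpoly_small/size_mk_monic. Qed.

Lemma coef_qXnM d x i : (i <= n)%N ->
  (q ^+ d * x : series)`_i = if (i < d)%N then 0 else x`_(i - d).
Proof.
move=> i_n; rewrite -{1}[x]in_qpolyK -rmorphXn -rmorphM coef_in_qpoly i_n.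
by rewrite coefXnM.
Qed.

Lemma coef_qXn d i : (i <= n)%N -> (q ^+ d : series)`_i = (i == d)%:R.
Proof. by move=> i_n; rewrite -rmorphXn coef_in_qpoly i_n coefXn. Qed.

Lemma qXnSn : q ^+ n.+1 = 0.
Proof.
apply/npolyP => i; have [i_n|i_n] := leqP i n; last first.
  by rewrite !big_coef_npoly // mk_monic_Xn size_polyXn.
by rewrite coef_qXn // coef0 ltn_eqF.
Qed.

Definition coefle x y := forall i, x`_i <= y`_i.

Lemma coefle_refl x : coefle x x.
Proof. by move=> i. Qed.

Lemma coefle01 : coefle 0 1.
Proof. by move=> i; rewrite coef0 coef1; case: eqP. Qed.

Lemma coefleD x x' y y' :
  coefle x y -> coefle x' y' -> coefle (x + x') (y + y').
Proof. by move=> le le' i; rewrite !coefD lerD. Qed.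

Lemma coefleM x x' y y' : coefle 0 x -> coefle 0 x' ->
  coefle x y -> coefle x' y' -> coefle (x * x') (y * y').
Proof.
move=> x0 x0' le le' i; rewrite !coef_qpolyM; case: ifP => // _.
apply: ler_sum => j _; apply: ler_pM; rewrite ?le ?le' //.
  by have := x0 j; rewrite coef0.
by have := x0' (i - j)%N; rewrite coef0.
Qed.

Lemma coefle_trans x y z : coefle x y -> coefle y z -> coefle x z.
Proof. by move=> xy yz i; apply: le_trans (xy i) (yz i). Qed.

Lemma coefle0D x y : coefle 0 x -> coefle 0 y -> coefle 0 (x + y).
Proof. by move=> x0 y0; have := coefleD x0 y0; rewrite addr0. Qed.

Lemma coefle0M x y : coefle 0 x -> coefle 0 y -> coefle 0 (x * y).
Proof.
move=> x0 y0; have := coefleM (coefle_refl 0) (coefle_refl 0) x0 y0.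
by rewrite mulr0.
Qed.

Lemma coefle_qX d : coefle 0 (q ^+ d).
Proof.
by move=> i; rewrite coef0 -rmorphXn coef_in_qpoly coefXn; do 2?case: ifP.
Qed.

Local Notation geom := (geom q n.+1).
Local Notation oddpr := (oddpr q).
Local Notation evenpr := (evenpr q n.+1).

Lemma coefle_geom d j : (j <= n)%N -> coefle (q ^+ d ^+ j) (geom d).
Proof.
move=> j_n; rewrite -[q ^+ d ^+ j]addr0 /geom.
rewrite (bigD1 (Ordinal (j_n : (j < n.+1)%N))) //=.
apply: coefleD; first exact: coefle_refl.
apply: big_ind => [|x y|i _]; [exact: coefle_refl | exact: coefle0D |].
by rewrite -exprM; apply: coefle_qX.
Qed.

Lemma coefle_geom1 d : coefle 1 (geom d).
Proof. by have := @coefle_geom d 0 isT; rewrite expr0. Qed.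

Lemma coefle1M x y : coefle 1 x -> coefle 1 y -> coefle 1 (x * y).
Proof.
move=> x1 y1; have := coefleM coefle01 coefle01 x1 y1.
by rewrite mulr1.
Qed.

Lemma coefle1_1Dq d : coefle 1 (1 + q ^+ d).
Proof.
have := coefleD (coefle_refl 1) (coefle_qX d); rewrite addr0; exact.
Qed.

Lemma coefle_evenpr m : coefle 1 (evenpr m).
Proof.
apply: big_ind => [|x y|i _]; [exact: coefle_refl | exact: coefle1M |].
exact: coefle_geom1.
Qed.

Lemma coefle_oddpr m : coefle 1 (oddpr m).
Proof.
apply: big_ind => [|x y|i _]; [exact: coefle_refl | exact: coefle1M |].
exact: coefle1_1Dq.
Qed.

Lemma coefle0_oddpr m : coefle 0 (oddpr m).
Proof. exact: coefle_trans coefle01 (coefle_oddpr m). Qed.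

Lemma coefle0_evenpr m : coefle 0 (evenpr m).
Proof. exact: coefle_trans coefle01 (coefle_evenpr m). Qed.

(** The factor 1 + q dominates both 1 and q; the other factors dominate 1. *)
Lemma coefle_odd (b : bool) k : coefle (q ^+ b) (oddpr k.+1).
Proof.
rewrite -[q ^+ b]mulr1 /oddpr big_ord_recl.
apply: coefleM; [exact: coefle_qX | exact: coefle01 | | ].
  case: b; last exact: coefle1_1Dq.
  by have := coefleD coefle01 (coefle_refl (q ^+ 1)); rewrite add0r.
apply: big_ind => [|x y|i _]; [exact: coefle_refl | exact: coefle1M |].
exact: coefle1_1Dq.
Qed.

Lemma coefle_even j k : (j <= n)%N -> coefle (q ^+ 2 ^+ j) (evenpr k.+1).
Proof.
move=> j_n; rewrite -[q ^+ 2 ^+ j]mulr1 /evenpr big_ord_recl.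
apply: coefleM; [|exact: coefle01 | exact: coefle_geom |].
  by rewrite -exprM; apply: coefle_qX.
apply: big_ind => [|x y|i _]; [exact: coefle_refl | exact: coefle1M |].
exact: coefle_geom1.
Qed.

(** Splitting j into its parity and twice its half finds q^j in (1 + q) / (1 - q^2). *)
Lemma coefle_oddpr_evenpr k j : (j <= n)%N ->
  coefle (q ^+ j) (oddpr k.+1 * evenpr k.+1).
Proof.
move=> j_n.
have -> : q ^+ j = q ^+ odd j * q ^+ 2 ^+ j./2.
  by rewrite -exprM -exprD mul2n odd_double_half.
apply: coefleM; [exact: coefle_qX | | exact: coefle_odd |].
  by rewrite -exprM; apply: coefle_qX.
apply: coefle_even; lia.
Qed.

Lemma coefle_remainder k :
  coefle (q ^+ (k.+1 * (2 * k.+1 + 1)) * (oddpr k.+1 * evenpr k.+1))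
         (remainder q n.+1 k.+1).
Proof.
rewrite /remainder [X in coefle _ X]mulrDr mulr1 mulrA -[X in coefle X]addr0.
apply: coefleD; first exact: coefle_refl.
(* The only negative factor, 1 - q^(2(k+1)), is absorbed by h_(k+1), leaving h_k. *)
rewrite mulrA -(mulrA _ (evenpr _)) evenprK //; last exact: qXnSn.
have oe0 i j : coefle 0 (oddpr i * evenpr j).
  exact: coefle0M (coefle0_oddpr _) (coefle0_evenpr _).
rewrite -(mulrA (q ^+ _)).
apply: coefle0M; first exact: coefle0M (coefle_qX _) (oe0 _ _).
apply: big_ind => [|x y|i _]; [exact: coefle_refl | exact: coefle0D |].
rewrite -exprM; apply: (coefle0M _ (coefle_qX _)).
exact: coefle0M (oe0 _ _) (coefle_trans coefle01 (coefle_geom1 _)).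
Qed.

Lemma remainder_ge0 k : 0 <= (remainder q n.+1 k.+1 : series)`_n.
Proof.
have le0 := coefle0M (coefle0_oddpr k.+1) (coefle0_evenpr k.+1).
have := coefle_trans (coefle0M (coefle_qX _) le0) (coefle_remainder k).
by move/(_ n); rewrite coef0.
Qed.

Lemma remainder_gt0 k : (k.+1 * (2 * k.+1 + 1) <= n)%N ->
  0 < (remainder q n.+1 k.+1 : series)`_n.
Proof.
set d := (k.+1 * _)%N => le_n.
(* The monomial q^n arises as q^d q^(n-d). *)
have le_q := coefleM (coefle_qX d) (coefle_qX (n - d)) (coefle_refl _)
  (@coefle_oddpr_evenpr k _ (leq_subr _ _)).
rewrite -exprD subnKC // in le_q.
have := coefle_trans le_q (coefle_remainder k).
by move/(_ n); rewrite coef_qXn // eqxx; apply: lt_le_trans.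
Qed.

End Coefficients.

(** * Recursion on the largest part *)

Definition bounded_pod m i (s : seq nat) : bool :=
  [&& is_partition i s, odd_parts_distinct s & all (geq m) s].

(** The bound on the parts left after removing a part m + 1: an odd part cannot recur, an even one
    can. *)
Definition next_bound m := if odd m.+1 then m else m.+1.

Lemma bounded_pod_cons m i s :
  bounded_pod m.+1 i (m.+1 :: s) =
  (m.+1 <= i)%N && bounded_pod (next_bound m) (i - m.+1) s.
Proof.
rewrite /bounded_pod /is_partition /odd_parts_distinct /next_bound.
rewrite [sorted _ _]path_sortedE; last by move=> x y z /= *; lia.
have -> : (sumn (m.+1 :: s) == i) = (m.+1 <= i)%N && (sumn s == i - m.+1)%N.
  by rewrite /=; lia.
have leS : all (geq m) s -> all (geq m.+1) s.
  by apply: sub_all => x /=; lia.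
rewrite [all (leq 1) _]/= [all (geq _) (_ :: _)]/= leqnn /=.
case: (leqP m.+1 i) => [le_i|_]; last by rewrite ?(andbF, andFb).
case: ifP => [m_odd|m_even]; last first.
  by case: (all (geq m.+1) s); case: sorted; case: all; case: eqP; case: uniq.
rewrite [uniq _]/= mem_filter /= m_odd /=.
have -> : all (geq m) s = all (geq m.+1) s && (m.+1 \notin s).
  apply/idP/andP => [le_s | [/allP le_s m_s]].
    split; first exact: leS.
    by apply/negP => /(allP le_s) /=; lia.
  apply/allP => x x_s; have /= := le_s x x_s.
  rewrite [(x <= m.+1)%N]leq_eqVlt => /orP[/eqP x_m|//].
  by rewrite -x_m x_s in m_s.
case: (all (geq m.+1) s); case: sorted; case: all; case: eqP; case: uniq => //=.
all: by case: (_ \in _).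
Qed.

(** The head is the largest part, so either it equals m + 1 or all parts are at most m. *)
Lemma bounded_podS m i s :
  bounded_pod m.+1 i s = bounded_pod m i s ||
    if s is x :: s' then [&& x == m.+1, (m.+1 <= i)%N
                           & bounded_pod (next_bound m) (i - m.+1) s']
    else false.
Proof.
case: s => [|x s]; first by rewrite orbF.
have [->|x_m] /= := eqVneq x m.+1.
  by rewrite bounded_pod_cons /bounded_pod /= ltnn !andbF.
rewrite orbF /bounded_pod /is_partition.
rewrite [sorted _ _]path_sortedE; last by move=> ? ? ? /= *; lia.
case s_x: (all (geq x) s) => //=.
congr [&& _, _ & _]; apply/andP/andP => -[] /= x_le s_le; (split; first by lia).
  by apply: sub_all s_x => y /=; lia.
by apply: sub_all s_le => y /=; lia.
Qed.

(** * The generating function of pod *)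

Section Count.
Variable n : nat.
Local Notation series := {poly %/ ('X^(n.+1) : {poly int})}.
Local Notation q := ('qX : series).

Definition podpr m : series :=
  \prod_(i < m) if odd i.+1 then 1 + q ^+ i.+1 else geom q n.+1 i.+1.

Lemma podpr_double m : podpr (2 * m) = oddpr q m * evenpr q n.+1 m.
Proof.
elim: m => [|m IHm]; first by rewrite /podpr /oddpr /evenpr !big_ord0 mulr1.
rewrite oddprS evenprS mulnS /podpr !big_ord_recr /= -/(podpr _) IHm.
rewrite oddM /= addn1 add2n; ring.
Qed.

(** Mirrors [bounded_podS]. For m + 1 even it is g = 1 + q^(m+1) g, where g inverts 1 - q^(m+1). *)
Lemma podprS m : podpr m.+1 = podpr m + q ^+ m.+1 * podpr (next_bound m).
Proof.
rewrite /next_bound {1}/podpr big_ord_recr /= -/(podpr m).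
case: ifP => m_odd; first by rewrite mulrDr mulr1 mulrC.
rewrite {3}/podpr big_ord_recr /= -/(podpr m) m_odd.
have := @geomK _ q n.+1 (qXnSn n) m.+1 isT.
move: (geom _ _ _) (podpr m) (q ^+ _) => g p Q gQ.
by rewrite -[X in _ = X + _]mulr1 -gQ; ring.
Qed.

(** An explicit duplicate-free list of the partitions makes the two cases of [bounded_podS] a
    concatenation. *)
Lemma bounded_pod_count m i : (i <= n)%N ->
  exists l : seq (seq nat),
    [/\ uniq l, (forall s, (s \in l) = bounded_pod m i s) & (size l)%:Z = (podpr m)`_i].
Proof.
elim: m i => [|m IHm] i.
  move=> i_n; exists (if i == 0%N then [:: [::]] else [::]); split.
  - by case: ifP.
  - case=> [|x s]; rewrite /bounded_pod /is_partition /= ?andbT.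
      by rewrite eq_sym; case: eqP.
    by case: x => [|x]; rewrite ?andbF //=; case: ifP.
  - by rewrite /podpr big_ord0 coef1; case: eqP.
(* An even part m + 1 keeps the bound and lowers only [i], hence the inner induction on [i]. *)
elim/ltn_ind: i => i IHi i_n; have [l [l_uniq l_mem l_size]] := IHm i i_n.
have [i_m|m_i] := ltnP i m.+1.
  exists l; split=> //.
    move=> s; rewrite l_mem bounded_podS; case: s => [|x s]; rewrite ?orbF //.
    by rewrite leqNgt i_m /= andbF orbF.
  by rewrite podprS coefD coef_qXnM // i_m addr0.
have [l' [l'_uniq l'_mem l'_size]] : exists l : seq (seq nat),
    [/\ uniq l, (forall s, (s \in l) = bounded_pod (next_bound m) (i - m.+1) s)
      & (size l)%:Z = (podpr (next_bound m))`_(i - m.+1)].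
  rewrite /next_bound; case: ifP => _; [apply: IHm | apply: IHi]; lia.
exists (l ++ [seq m.+1 :: s | s <- l']); split.
- rewrite cat_uniq l_uniq map_inj_uniq ?l'_uniq ?andbT; last by move=> ? ? [].
  apply/hasPn => _ /mapP[s _ ->] /=.
  by rewrite l_mem /bounded_pod /= ltnn !andbF.
- move=> s; rewrite mem_cat l_mem bounded_podS; congr (_ || _).
  case: s => [|x s]; first by apply/mapP => -[].
  apply/mapP/and3P => [[s' s'_l [-> ->]] | [/eqP-> _ s_l]].
    by rewrite eqxx m_i -l'_mem.
  by exists s; rewrite ?l'_mem.
- rewrite size_cat size_map PoszD l_size l'_size podprS coefD coef_qXnM //.
  by rewrite ltnNge m_i.
Qed.

(** Parts of a partition of j never exceed j, so any bound m >= j counts them all. *)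
Lemma pod_natE j m : (j <= m)%N -> (j <= n)%N ->
  (pod_nat j)%:Z = (podpr m)`_j.
Proof.
move=> j_m j_n; have [l [l_uniq l_mem <-]] := bounded_pod_count m j_n.
congr Posz; rewrite /pod_nat cardE.
rewrite -(size_map (fun s : j.-bseq 'I_j.+1 => map val s)).
apply: perm_size; apply: uniq_perm => //.
  rewrite map_inj_uniq ?enum_uniq // => s t /(inj_map val_inj).
  exact: val_inj.
move=> s; rewrite l_mem; apply/mapP/idP => [|s_pod].
  move=> [t]; rewrite mem_enum inE => /andP[t_part t_odd] ->.
  rewrite /bounded_pod t_part t_odd /=.
  by apply/allP => _ /mapP[x _ ->] /=; have := ltn_ord x; lia.
case/and3P: s_pod => s_part s_odd _.
have /and3P[_ s_pos /eqP s_sum] := s_part.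
have s_size : (size s <= j)%N.
  rewrite -s_sum; elim: (s) s_pos => //= x t IHt /andP[x0 /IHt].
  lia.
have s_le x : x \in s -> (x <= j)%N.
  rewrite -s_sum; elim: (s) => //= y t IHt.
  rewrite inE => /orP[/eqP->|/IHt]; lia.
have t_size : (size (map (@inord j) s) <= j)%N by rewrite size_map.
(* Parts are at most j, so [inord] preserves them; being positive, they number at most j. *)
have sK : s = map val (Bseq t_size).
  rewrite /= -map_comp -[LHS]map_id; apply/eq_in_map => x x_s /=.
  by rewrite inordK // ltnS s_le.
by exists (Bseq t_size) => //; rewrite mem_enum inE -sK s_part.
Qed.

End Count.

(** * From power series to the inequalities *)

Lemma coef_signM n (x : {poly %/ ('X^(n.+1) : {poly int})}) j i :
  ((-1) ^+ j * x)`_i = (-1) ^+ j * x`_i.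
Proof.
rewrite -signr_odd -[in RHS]signr_odd; case: (odd j); rewrite ?mul1r //.
by rewrite expr1 !mulN1r coefN.
Qed.

(** The product up to 2(n+1) is P modulo q^(n+1). For d > n both sides vanish, as pod is 0 at
    negative integers. *)
Lemma coef_qXnM_pod n d :
  ('qX ^+ d * podpr n (2 * n.+1))`_n = pod (n%:Z - d%:Z).
Proof.
rewrite coef_qXnM //; case: ltnP => [n_d | d_n].
  by rewrite -opprB subzn 1?ltnW // -(prednK (n := d - n)) ?subn_gt0.
by rewrite subzn // -pod_natE //=; lia.
Qed.

Lemma pod_sum_remainder n k : (0 < n)%N ->
  (-1) ^+ k * (\sum_(0 <= j < k.+1)
     (-1) ^+ j * (pod (n%:Z - (j * (2 * j + 1))%N%:Z)
                  - pod (n%:Z - ((j + 1) * (2 * j + 1))%N%:Z)))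
  = (remainder ('qX : {poly %/ ('X^(n.+1) : {poly int})}) n.+1 k.+1)`_n.
Proof.
move=> n0.
have := theta_truncation (ltn0Sn n) (qXnSn n) k.+1.
rewrite -podpr_double [X in X = _ -> _]mulr_sumr => /npolyP/(_ n).
rewrite coefn_sum coefB coef_signM coef1.
(* Since n > 0, the summand 1 of the identity does not reach coefficient n. *)
rewrite (gtn_eqF n0) sub0r (exprS (-1 : int)) mulN1r mulNr opprK => sumE.
rewrite -[RHS](signrMK k) -sumE; congr (_ * _); apply: eq_bigr => j _.
rewrite mulrCA coef_signM; congr (_ * _).
by rewrite mulrBr coefB !(mulrC (podpr _ _)) !coef_qXnM_pod.
Qed.

Theorem corollary1p4 :
  (forall n k : nat, (1 <= n)%N -> (1 <= k)%N ->
     let S : int :=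
       (-1) ^+ (k - 1) *
       \sum_(0 <= j < k)
          (-1) ^+ j * (pod (n%:Z - (j * (2 * j + 1))%N%:Z)
                       - pod (n%:Z - ((j + 1) * (2 * j + 1))%N%:Z)) in
     0 <= S /\ (((2 * k + 1) * k <= n)%N -> 0 < S)) /\
  (forall n : nat, (1 <= n)%N ->
     pod n%:Z - pod (n%:Z - 1) - pod (n%:Z - 3) + pod (n%:Z - 6) <= 0 /\
     0 <= pod n%:Z - pod (n%:Z - 1) - pod (n%:Z - 3) + pod (n%:Z - 6)
          + pod (n%:Z - 10) - pod (n%:Z - 15)).
Proof.
split=> [n [//|k] n_gt0 _ /=|n n_gt0].
  rewrite subn1 pod_sum_remainder //.
  split=> [|k_n]; first exact: remainder_ge0.
  by apply: remainder_gt0; rewrite mulnC.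
(* The two examples are the cases k = 2 and k = 3. *)
have := remainder_ge0 n 1; have := remainder_ge0 n 2.
rewrite -!pod_sum_remainder // !big_nat_recr //= big_nil addn0.
rewrite -[(1 * _)%N]/3%N -[((0 + 1) * _)%N]/1%N -[((1 + 1) * _)%N]/6%N.
rewrite -[(2 * _)%N]/10%N -[((2 + 1) * _)%N]/15%N.
rewrite -[1%N%:Z]/(1 : int) -[3%N%:Z]/(3 : int) -[6%N%:Z]/(6 : int).
rewrite -[10%N%:Z]/(10 : int) -[15%N%:Z]/(15 : int).
rewrite !(expr0, expr1, sqrrN, expr1n).
move: (pod _) (pod _) (pod _) (pod _) (pod _) => a b c d e; lia.
Qed.
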